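(* Let $\mathcal{P}\subset\Delta(\mathcal{S})^{\mathcal{S}\times\mathcal{A}}$ be a nonempty compact convex uncertainty set that is weakly s-tractable. Let $r\in\mathbb{R}^{\mathcal{S}\times\mathcal{A}}$, $\gamma\in(0,1)$ and $\mu\in\Delta(\mathcal{S})$. Then $$\sup_{\pi\in\Pi_{\mathsf H}}\inf_{P\in\mathcal{P}_{\mathsf H}}\mu^\top v^{\pi,P}=\sup_{\pi\in\Pi_{\mathsf H}}\min_{P\in\mathcal{P}}\mu^\top v^{\pi,P}.$$
   Context: $\mathcal{S}$ (states) and $\mathcal{A}$ (actions) are finite nonempty sets; $\Delta(E)$ denotes the set of probability distributions on a finite set $E$. Elements of an uncertainty set $\mathcal{P} \subset \Delta(\mathcal{S})^{\mathcal{S}\times\mathcal{A}}$ are written $P=(P_{sa})_{(s,a)}$ with $P_{sa}\in\Delta(\mathcal{S})\subset\mathbb{R}^{\mathcal{S}}$. $\Pi_{\mathsf H}$ is the set of history-dependent policies, i.e. maps from finite histories $h_t=(s_0,a_0,\dots,s_{t-1},a_{t-1},s_t)$, $t\ge 0$, to $\Delta(\mathcal{A})$; $\Pi_{\mathsf S}=\Delta(\mathcal{A})^{\mathcal{S}}\subset\Pi_{\mathsf H}$ is the set of stationary policies, $\pi=(\pi_{sa})$. $\mathcal{P}_{\mathsf H}$ is the set of history-dependent (non-stationary) adversaries: maps $P$ assigning to each finite history $h_t$ an element $P(h_t)\in\mathcal{P}$; at time $t$, after action $a_t$ is drawn, the next state is drawn from $P(h_t)_{s_ta_t}$. Constant maps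 are identified with elements of $\mathcal{P}$. Rewards are independent of the next state: $r=(r_{sa})\in\mathbb{R}^{\mathcal{S}\times\mathcal{A}}$. For $\gamma\in[0,1)$, $v^{\pi,P}_s=\mathbb{E}^{\pi,P}\big[\sum_{t\ge 0}\gamma^t r_{s_ta_t}\,\big|\,s_0=s\big]$ (with $0^0=1$), for $\pi\in\Pi_{\mathsf H}$ and $P\in\mathcal{P}$ or $P\in\mathcal{P}_{\mathsf H}$. For $\pi\in\Pi_{\mathsf S}$, $u^{\pi}\in\mathbb{R}^{\mathcal{S}}$ is the unique vector satisfying $u^\pi_s=\min_{P\in\mathcal{P}}\sum_{a}\pi_{sa}(r_{sa}+\gamma P_{sa}^\top u^\pi)$ for all $s$. $\mathcal{P}$ is weakly s-tractable if for all $\pi\in\Pi_{\mathsf S}$, $r\in\mathbb{R}^{\mathcal{S}\times\mathcal{A}}$, $\gamma\in[0,1)$, $\mu\in\Delta(\mathcal{S})$: $\min_{P\in\mathcal{P}}\mu^\top v^{\pi,P}=\mu^\top u^\pi$. *)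

(* Defs.v *)
From HB Require Import structures.
From mathcomp Require Import all_boot all_order all_algebra.
From mathcomp Require Import all_classical all_reals all_analysis.

Set Implicit Arguments.
Unset Strict Implicit.
Unset Printing Implicit Defensive.

Import Order.TTheory GRing.Theory Num.Theory.
Import numFieldNormedType.Exports.

Local Open Scope classical_set_scope.
Local Open Scope ring_scope.

Definition is_dist (R : realType) (E : finType) (p : E -> R) : Prop :=
  (forall e, 0 <= p e) /\ \sum_e p e = 1.

Definition is_min (R : realType) (X : set R) (m : R) : Prop := X m /\ lbound X m.

(* An element P of transition R S A is uncurried: P (s, a, s') is the s'-entry of
   P_{sa}.  As a topological space, transition R S A is R^(S * A * S) with the
   product topology, i.e. the usual topology of a finite power of R. *)
Definition transition (R : realType) (S A : finType) := {ptws S * A * S -> R}.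

Definition is_transition (R : realType) (S A : finType) (P : transition R S A) : Prop :=
  forall s a, is_dist (fun s' => P (s, a, s')).

(* The history (s_0, a_0, ..., s_{t-1}, a_{t-1}, s_t) is the pair
   ([:: (s_0, a_0); ...; (s_{t-1}, a_{t-1})], s_t). *)
Definition history (S A : finType) := (seq (S * A) * S)%type.

Definition policyH (R : realType) (S A : finType) : set (history S A -> A -> R) :=
  [set pi | forall h, is_dist (pi h)].

Definition policyS (R : realType) (S A : finType) : set (S -> A -> R) :=
  [set pi | forall s, is_dist (pi s)].

Definition stationary (R : realType) (S A : finType) (pi : S -> A -> R) :
  history S A -> A -> R := fun h => pi h.2.

Definition adversaryH (R : realType) (S A : finType) (U : set (transition R S A)) :
  set (history S A -> transition R S A) := [set P | forall h, U (P h)].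

Definition history_at (S A : finType) (T : Type)
    (X : nat -> T -> S) (Y : nat -> T -> A) (t : nat) (w : T) : history S A :=
  ([seq (X i w, Y i w) | i <- iota 0 t], X t w).

(* The random states X_t and actions Y_t on the probability space (T, Q) follow
   policy pi against adversary P from state s.  The last two clauses are the
   conditional laws of Y_t given h_t and of X_{t+1} given (h_t, Y_t), written as
   products so that they are also meaningful for histories of probability 0. *)
Definition controlled_process (R : realType) (S A : finType)
    (pi : history S A -> A -> R) (P : history S A -> transition R S A) (s : S)
    (d : measure_display) (T : measurableType d) (Q : probability T R)
    (X : nat -> T -> S) (Y : nat -> T -> A) : Prop :=
  [/\ forall t x, measurable [set w | X t w = x],
      forall t a, measurable [set w | Y t w = a],
      Q [set w | X 0%N w = s] = 1%E,
      forall t h a,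
        Q [set w | history_at X Y t w = h /\ Y t w = a] =
        (Q [set w | history_at X Y t w = h] * (pi h a)%:E)%E &
      forall t h a x,
        Q [set w | [/\ history_at X Y t w = h, Y t w = a & X t.+1 w = x]] =
        (Q [set w | history_at X Y t w = h /\ Y t w = a] *
         (P h (h.2, a, x))%:E)%E].

Definition discounted_return (R : realType) (S A : finType) (r : S -> A -> R)
    (gamma : R) (T : Type) (X : nat -> T -> S) (Y : nat -> T -> A) (w : T) : R :=
  limn (series (fun t => gamma ^+ t * r (X t w) (Y t w))).

(* v^{pi,P}_s.  The clauses of controlled_process determine the law of
   (X_0, Y_0, X_1, ...), and for kernels and policies valued in distributions
   such a process exists (Ionescu-Tulcea), so the set below is a singleton: the
   expectation does not depend on the realization. *)
Definition value (R : realType) (S A : finType) (r : S -> A -> R) (gamma : R)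
    (pi : history S A -> A -> R) (P : history S A -> transition R S A) (s : S) : R :=
  get [set v : R | exists (d : measure_display) (T : measurableType d)
      (Q : probability T R) (X : nat -> T -> S) (Y : nat -> T -> A),
      controlled_process pi P s Q X Y /\
      v%:E = ('E_Q[discounted_return r gamma X Y])%E].

Definition avg_value (R : realType) (S A : finType) (r : S -> A -> R) (gamma : R)
    (mu : S -> R) (pi : history S A -> A -> R) (P : history S A -> transition R S A) : R :=
  \sum_s mu s * value r gamma pi P s.

(* u = u^pi: for a nonempty compact U of kernels and 0 <= gamma < 1 there is
   exactly one such u. *)
Definition is_robust_value (R : realType) (S A : finType) (U : set (transition R S A))
    (r : S -> A -> R) (gamma : R) (pi : S -> A -> R) (u : S -> R) : Prop :=
  forall s, is_min
    [set \sum_a pi s a * (r s a + gamma * \sum_s' P (s, a, s') * u s') | P in U]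
    (u s).

Definition weakly_s_tractable (R : realType) (S A : finType)
    (U : set (transition R S A)) : Prop :=
  forall (pi : S -> A -> R) (r : S -> A -> R) (gamma : R) (mu u : S -> R),
    policyS pi -> 0 <= gamma < 1 -> is_dist mu ->
    is_robust_value U r gamma pi u ->
    is_min [set avg_value r gamma mu (stationary pi) (cst P) | P in U]
           (\sum_s mu s * u s).

(* Main.v *)
Require Import Defs.
From HB Require Import structures.
From mathcomp Require Import all_boot all_order all_algebra.
From mathcomp Require Import all_classical all_reals all_analysis.
From mathcomp Require Import measurable_realfun ring lra.
Import Order.TTheory GRing.Theory Num.Theory.
Import numFieldNormedType.Exports.
Local Open Scope classical_set_scope.
Local Open Scope ring_scope.

(** A history-dependent adversary has more power than a constant one, so only the
    inequality [>=] between the two suprema needs a proof. Both are compared with the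
    average over [mu] of [v], the value of the s-rectangular game in which the
    adversary chooses a new kernel from [U] at every step, knowing the state and the
    mixed action. The function [v] is a fixed point, up to arbitrarily small errors, of
    the one-step max-min operator ([robust_fixpoint]).

    The supremum against history-dependent adversaries is at least the average of [v]:
    play at every state a mixed action that is almost optimal in one step. Whatever
    kernel the adversary uses then, one step costs at most a small error, and the
    discount makes the total error small ([value_eps_optimal]).

    The supremum against constant kernels is at most the average of [v]: there is a
    single kernel [P] in [U] such that no action at any state gains more than [v] in
    one step ([saddle_kernel]); against it even history-dependent policies get at most
    [v] ([value_le]). The existence of [P] is a statement about finitely many affine
    inequalities on the compact convex set [U], so by a theorem of the alternative
    ([convexlike_alternative]) it is enough to satisfy each nonnegative combination of
    them. The weights of such a combination are, up to scaling at each state, a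
    stationary policy. This is where tractability enters ([tractable_minimizer]): for
    every stationary policy and every continuation value, some kernel in [U] minimizes
    the one-step value at all states simultaneously, because a suitable choice of the
    rewards makes the given continuation the robust value of the policy.

    All this concerns one-step inequalities. They are transferred to the value through
    finite-horizon values, defined by backward recursion, which converge to the value
    at a geometric rate that does not depend on the kernels
    ([horizon_value_cvg], [horizon_value_dist_le]). Since the value is an expectation on
    some probability space carrying the process, such a space has to be constructed
    ([controlled_process_exists]): cut the unit interval successively according to the
    laws of the next action and state, and read off the pieces that contain a uniform
    random number. The uniform rate also makes the value continuous in the kernel, so
    that the minimum over the compact set [U] is attained ([continuous_value]). *)

(** * Finite-horizon values *)

Lemma is_dist_sum_le {R : realType} {E : finType} (p f : E -> R) (c : R) :
  is_dist p -> (forall e, f e <= c) -> \sum_e p e * f e <= c.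
Proof.
move=> [p0 p1] fc; rewrite -[leRHS]mul1r -p1 mulr_suml.
by apply: ler_sum => e _; exact: ler_wpM2l.
Qed.

Lemma is_dist_sum_ge {R : realType} {E : finType} (p f : E -> R) (c : R) :
  is_dist p -> (forall e, c <= f e) -> c <= \sum_e p e * f e.
Proof.
move=> [p0 p1] fc; rewrite -[leLHS]mul1r -p1 mulr_suml.
by apply: ler_sum => e _; exact: ler_wpM2l.
Qed.

Lemma is_dist_inhabited {R : realType} {E : finType} (p : E -> R) : is_dist p -> inhabited E.
Proof.
move=> [_ p1]; case: (pickP (mem E)) => [e _|E0]; first exact: inhabits e.
by move: p1; rewrite big_pred0// => /esym/eqP; rewrite oner_eq0.
Qed.

Lemma is_dist_dirac {R : realType} {E : finType} (e0 : E) :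
  is_dist (fun e => (e == e0)%:R : R).
Proof.
split=> [e|]; first exact: ler0n.
by rewrite (bigD1 e0)//= eqxx big1 ?addr0// => e /negPf ->.
Qed.

Definition reward_bound {R : realType} {S A : finType} (r : S -> A -> R) : R :=
  \sum_s \sum_a `|r s a|.

Lemma reward_bound_ge0 {R : realType} {S A : finType} (r : S -> A -> R) :
  0 <= reward_bound r.
Proof. by apply: sumr_ge0 => s _; exact: sumr_ge0. Qed.

Lemma reward_le_bound {R : realType} {S A : finType} (r : S -> A -> R) s a :
  `|r s a| <= reward_bound r.
Proof.
rewrite /reward_bound (bigD1 s)//= (bigD1 a)//= -addrA lerDl addr_ge0//.
  exact: sumr_ge0.
by apply: sumr_ge0 => ? _; exact: sumr_ge0.
Qed.

(** The continuation value [v a x] may depend on the action: along histories the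
    action becomes part of the past. *)
Definition stage_value {R : realType} {S A : finType} (r : S -> A -> R) (gamma : R)
    (s : S) (p : A -> R) (P : transition R S A) (v : A -> S -> R) : R :=
  \sum_a p a * (r s a + gamma * \sum_x P (s, a, x) * v a x).

Fixpoint horizon_value {R : realType} {S A : finType} (r : S -> A -> R) (gamma : R)
    (pi : history S A -> A -> R) (P : history S A -> transition R S A)
    (n : nat) (h : history S A) : R :=
  if n is m.+1 then
    stage_value r gamma h.2 (pi h) (P h)
      (fun a x => horizon_value r gamma pi P m (rcons h.1 (h.2, a), x))
  else 0.

(** One step is a monotone gamma-contraction of the continuation value; every
    estimate on values below is this one, iterated. *)
Lemma stage_value_le {R : realType} {S A : finType} (r : S -> A -> R) (gamma : R)
    (s : S) (p : A -> R) (P : transition R S A) (v w : A -> S -> R) (c : R) :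
  0 <= gamma -> is_dist p -> is_transition P ->
  (forall a x, v a x <= w a x + c) ->
  stage_value r gamma s p P v <= stage_value r gamma s p P w + gamma * c.
Proof.
move=> g0 dp dP vw.
suff: stage_value r gamma s p P v - stage_value r gamma s p P w <= gamma * c by lra.
rewrite -sumrB (eq_bigr (fun a => p a *
  (gamma * \sum_x P (s, a, x) * (v a x - w a x)))); last first.
  move=> a _; rewrite -mulrBr; congr (_ * _); rewrite opprD addrACA subrr add0r.
  by rewrite -mulrBr -sumrB; congr (_ * _); apply: eq_bigr => x _; rewrite mulrBr.
apply: is_dist_sum_le => // a; apply: ler_wpM2l => //.
by apply: is_dist_sum_le => // x; rewrite lerBlDl.
Qed.

Section HorizonBounds.
Context {R : realType} {S A : finType} (r : S -> A -> R) (gamma : R).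
Context (pi : history S A -> A -> R) (P : history S A -> transition R S A).
Hypothesis gamma_ge0 : 0 <= gamma.
Hypothesis pi_policy : policyH pi.
Hypothesis P_transition : forall h, is_transition (P h).

(** At horizon 0 the bound holds with the error [C], and each further step
    multiplies the error by gamma; in the limit a supersolution [w] of the one-step
    equation dominates the value. The decision maker may remember the past although
    [w] depends on the current state only. *)
Lemma horizon_value_le (w : S -> R) (C : R) :
  (forall s, - C <= w s) ->
  (forall h, stage_value r gamma h.2 (pi h) (P h) (fun=> w) <= w h.2) ->
  forall n h, horizon_value r gamma pi P n h <= w h.2 + gamma ^+ n * C.
Proof.
move=> wC Tw; elim=> [|n IH] h /=; first by have := wC h.2; lra.
apply: (le_trans (@stage_value_le _ _ _ r gamma h.2 (pi h) (P h) _ (fun=> w)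
  (gamma ^+ n * C) gamma_ge0 (pi_policy h) (P_transition h) _)).
  by move=> a x; exact: (IH (_, x)).
by rewrite exprS -mulrA lerD2r; exact: Tw.
Qed.

Lemma horizon_value_ge (w : S -> R) (C : R) :
  (forall s, w s <= C) ->
  (forall h, w h.2 <= stage_value r gamma h.2 (pi h) (P h) (fun=> w)) ->
  forall n h, w h.2 - gamma ^+ n * C <= horizon_value r gamma pi P n h.
Proof.
move=> wC Tw; elim=> [|n IH] h /=; first by have := wC h.2; lra.
rewrite lerBlDr exprS -mulrA; apply: (le_trans (Tw h)).
apply: stage_value_le => // a x.
by have := IH (rcons h.1 (h.2, a), x); rewrite /=; lra.
Qed.

Hypothesis gamma_lt1 : gamma < 1.

Let B := reward_bound r.

Lemma horizon_value_norm_le n h : `|horizon_value r gamma pi P n h| <= B / (1 - gamma).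
Proof.
have g1 : 1 - gamma != 0 by rewrite subr_eq0 gt_eqF.
have fixB : B / (1 - gamma) = B + gamma * (B / (1 - gamma)) by field.
elim: n h => [|n IH] h /=.
  by rewrite normr0 divr_ge0 ?reward_bound_ge0// subr_ge0 ltW.
have rB a : - B <= r h.2 a <= B by rewrite -ler_norml reward_le_bound.
have IHB a x : - (B / (1 - gamma)) <=
    horizon_value r gamma pi P n (rcons h.1 (h.2, a), x) <= B / (1 - gamma).
  by rewrite -ler_norml.
rewrite ler_norml; apply/andP; split.
  apply: is_dist_sum_ge => // a; rewrite fixB opprD; apply: lerD.
    by have /andP[] := rB a.
  rewrite -mulrN; apply: ler_wpM2l => //; apply: is_dist_sum_ge; first exact: P_transition.
  by move=> x; have /andP[] := IHB a x.
apply: is_dist_sum_le => // a; rewrite fixB; apply: lerD.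
  by have /andP[] := rB a.
apply: ler_wpM2l => //; apply: is_dist_sum_le; first exact: P_transition.
by move=> x; have /andP[] := IHB a x.
Qed.

(** The rate is uniform in the policy and the kernels; this is what makes the value
    continuous in the kernel. *)
Lemma horizon_value_dist_le n k h :
  `|horizon_value r gamma pi P (n + k) h - horizon_value r gamma pi P n h|
    <= gamma ^+ n * (B / (1 - gamma)).
Proof.
elim: n k h => [|n IH] k h.
  by rewrite add0n /= subr0 mul1r; exact: horizon_value_norm_le.
rewrite addSn /= exprS -mulrA.
rewrite ler_norml lerBlDl lerBrDr addrC lerBlDr; apply/andP; split.
  apply: stage_value_le => // a x; move: (IH k (rcons h.1 (h.2, a), x)).
  by rewrite ler_norml => /andP[]; lra.
apply: stage_value_le => // a x; move: (IH k (rcons h.1 (h.2, a), x)).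
by rewrite ler_norml => /andP[]; lra.
Qed.

End HorizonBounds.

(** * The expected discounted return of a controlled process *)

Lemma Rintegral_sum {d} {T : measurableType d} {R : realType}
    (mu : {measure set T -> \bar R}) (I : finType) (f : I -> T -> R) :
  (forall i, mu.-integrable setT (EFin \o f i)) ->
  \int[mu]_w (\sum_i f i w) = \sum_i \int[mu]_w f i w.
Proof.
move=> intf; rewrite /Rintegral.
under eq_integral do rewrite -sumEFin.
rewrite (integral_sum measurableT (fun i => intf i)) sum_fine// => i _.
exact: (integrable_fin_num measurableT (intf i)).
Qed.

Lemma integrable_indic_bounded {d} {T : measurableType d} {R : realType}
    {Q : probability T R} {E : set T} {f : T -> R} {M : R} :
  measurable E -> measurable_fun setT f -> (forall w, `|f w| <= M) ->
  Q.-integrable setT (EFin \o (fun w => \1_E w * f w)).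
Proof.
move=> mE mf fM; apply: measurable_bounded_integrable => //.
- by rewrite [X in (X < _)%E](probability_setT Q) ltry.
- by apply: measurable_funM => //; exact: measurable_indic.
- exists M; split=> [|M' ltM w _]; first exact: num_real.
  apply: le_trans (ltW ltM); rewrite normrM indicE -[leRHS]mul1r; apply: ler_pM => //.
  by case: (_ \in _); rewrite ?normr0 ?normr1.
Qed.

Section ProcessValue.
Context {R : realType} {S A : finType} (r : S -> A -> R) (gamma : R).
Context (pi : history S A -> A -> R) (P : history S A -> transition R S A) (s : S).
Context {d : measure_display} {T : measurableType d} (Q : probability T R).
Context (X : nat -> T -> S) (Y : nat -> T -> A).
Hypothesis P_transition : forall h, is_transition (P h).
Hypothesis proc : controlled_process pi P s Q X Y.
Hypothesis gamma_ge0 : 0 <= gamma.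
Hypothesis gamma_lt1 : gamma < 1.

(** The discounted reward of the [n] periods from time [t] on, discounted back to
    time [t]: this shift makes the recursion the one of [horizon_value]. *)
Fixpoint gain (n t : nat) (w : T) : R :=
  if n is m.+1 then r (X t w) (Y t w) + gamma * gain m t.+1 w else 0.

Let hist_event t h := [set w | history_at X Y t w = h].

Lemma history_atS t w :
  history_at X Y t.+1 w =
  (rcons (history_at X Y t w).1 (X t w, Y t w), X t.+1 w).
Proof. by rewrite /history_at -[in iota _ _]addn1 iotaD map_cat /= cats1. Qed.

Lemma history_atSP t w h a x :
  history_at X Y t.+1 w = (rcons h.1 (h.2, a), x) <->
  [/\ history_at X Y t w = h, Y t w = a & X t.+1 w = x].
Proof.
case: h => l y; rewrite history_atS; split=> [[/rcons_inj[<- <- <-] <-]//|].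
by case=> -[<- <-] <- <-.
Qed.

(** A nonempty past ends with a state-action pair, so that the event splits into
    the one of the shorter history and two elementary events. *)
Lemma measurable_hist_event t h : measurable (hist_event t h).
Proof.
have [mX mY _ _ _] := proc.
elim: t h => [|t IH] [l x].
  rewrite /hist_event; case: l => [|c l].
    rewrite (_ : [set _ | _] = [set w | X 0%N w = x]); first exact: mX.
    by apply/seteqP; split=> w; rewrite /history_at /=; [case|move=> ->].
  rewrite (_ : [set _ | _] = set0); first exact: measurable0.
  by rewrite -subset0 => w /=; rewrite /history_at.
case: (lastP l) => [|l' [y a]].
  rewrite /hist_event (_ : [set _ | _] = set0); first exact: measurable0.
  by rewrite -subset0 => w /=; rewrite history_atS => -[]; case: (map _ _).
rewrite (_ : hist_event _ _ = hist_event t (l', y) `&`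
  ([set w | Y t w = a] `&` [set w | X t.+1 w = x])).
  by apply: measurableI => //; exact: measurableI.
apply/seteqP; split=> w.
  by move/(history_atSP t w (l', y) a x) => [].
by move=> [? [? ?]]; apply/(history_atSP t w (l', y) a x).
Qed.

Lemma measurable_reward t : measurable_fun setT (fun w => r (X t w) (Y t w)).
Proof.
have [mX mY _ _ _] := proc.
rewrite (_ : (fun _ => _) = (fun w => \sum_(c : S * A) r c.1 c.2 *
  \1_([set w | X t w = c.1] `&` [set w | Y t w = c.2]) w)).
  apply: measurable_sum => c; apply: measurable_funM; first exact: measurable_cst.
  by apply: measurable_indic; exact: measurableI.
apply/funext => w; rewrite (bigD1 (X t w, Y t w))//= big1 => [|[x a] ne].
  by rewrite addr0 indicE mem_set ?mulr1.
rewrite indicE memNset ?mulr0// => -[/= e1 e2].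
by move: ne; rewrite e1 e2 eqxx.
Qed.

Lemma measurable_gain n t : measurable_fun setT (gain n t).
Proof.
elim: n t => [|n IH] t; first exact: measurable_cst.
apply: measurable_funD; first exact: measurable_reward.
by apply: measurable_funM; [exact: measurable_cst|exact: IH].
Qed.

Let B := reward_bound r.

Lemma gain_norm_le n t w : `|gain n t w| <= B / (1 - gamma).
Proof.
have g1 : 1 - gamma != 0 by rewrite subr_eq0 gt_eqF.
have fixB : B / (1 - gamma) = B + gamma * (B / (1 - gamma)) by field.
elim: n t => [|n IH] t /=.
  by rewrite normr0 divr_ge0 ?reward_bound_ge0 ?subr_ge0 ?(ltW gamma_lt1).
rewrite fixB; apply: le_trans (ler_normD _ _) _; apply: lerD; first exact: reward_le_bound.
by rewrite normrM (ger0_norm gamma_ge0); exact: ler_wpM2l.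
Qed.

Lemma gainE n t w :
  gain n t w = \sum_(0 <= k < n) gamma ^+ k * r (X (t + k)%N w) (Y (t + k)%N w).
Proof.
elim: n t => [|n IH] t /=; first by rewrite big_nil.
rewrite big_nat_recl//= expr0 mul1r addn0; congr (_ + _).
rewrite IH mulr_sumr; apply: eq_bigr => k _.
by rewrite exprS mulrA addSnnS.
Qed.

Lemma probability_hist_step t h a x :
  Q (hist_event t.+1 (rcons h.1 (h.2, a), x)) =
  (Q (hist_event t h) * (pi h a)%:E * (P h (h.2, a, x))%:E)%E.
Proof.
have [_ _ _ HY HX] := proc.
rewrite -HY -HX; congr (Q _); apply/seteqP; split=> w /=.
  by move/history_atSP.
by move=> ?; apply/history_atSP.
Qed.

(** Induction on the horizon: the event of the history [h] is the disjoint union,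
    over the next action and the next state, of the events of the one-step longer
    histories, and on each of these the first reward is a constant. *)
Lemma expected_gain_on_history n t h :
  \int[Q]_w (\1_(hist_event t h) w * gain n t w) =
  fine (Q (hist_event t h)) * horizon_value r gamma pi P n h.
Proof.
elim: n t h => [|n IH] t h.
  rewrite /= mulr0; under eq_Rintegral do rewrite mulr0.
  by rewrite Rintegral_cst// mul0r.
pose f (c : A * S) w := \1_(hist_event t.+1 (rcons h.1 (h.2, c.1), c.2)) w *
  (r h.2 c.1 + gamma * gain n t.+1 w).
transitivity (\int[Q]_w \sum_c f c w).
  apply: eq_Rintegral => w _ /=; rewrite indicE.
  have [e|ne] := pselect (hist_event t h w); last first.
    rewrite memNset// mul0r big1// => c _; rewrite /f indicE memNset ?mul0r//.
    by move/history_atSP => [].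
  rewrite mem_set// mul1r (bigD1 (Y t w, X t.+1 w))//= big1 => [|[a x] nc].
    rewrite addr0 /f indicE mem_set ?mul1r; last by apply/history_atSP.
    by rewrite (_ : h.2 = X t w)// -e.
  rewrite /f indicE memNset ?mul0r// => /history_atSP[_ /= e1 e2].
  by move: nc; rewrite -e1 -e2 eqxx.
have intg (g : T -> R) (M : R) h' t' : measurable_fun setT g -> (forall w, `|g w| <= M) ->
    Q.-integrable setT (EFin \o (fun w => \1_(hist_event t' h') w * g w)).
  by move=> mg gM; apply: integrable_indic_bounded mg gM; exact: measurable_hist_event.
have intc h' t' (c : R) := intg (cst c) `|c| h' t' (measurable_cst c) (fun=> lexx _).
have intG h' t' m u := intg _ _ h' t' (measurable_gain m u) (gain_norm_le m u).
have fE c : f c = (fun w =>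
    \1_(hist_event t.+1 (rcons h.1 (h.2, c.1), c.2)) w * r h.2 c.1 +
    gamma * (\1_(hist_event t.+1 (rcons h.1 (h.2, c.1), c.2)) w * gain n t.+1 w)).
  by apply/funext => w; rewrite /f mulrDr (mulrCA gamma).
have intgG c : Q.-integrable setT (EFin \o (fun w =>
    gamma * (\1_(hist_event t.+1 (rcons h.1 (h.2, c.1), c.2)) w * gain n t.+1 w))).
  rewrite (_ : _ \o _ = (fun w => gamma%:E *
    (\1_(hist_event t.+1 (rcons h.1 (h.2, c.1), c.2)) w * gain n t.+1 w)%:E)%E)//.
  by apply: integrableZl => //; exact: intG.
rewrite Rintegral_sum; last first.
  move=> c; rewrite fE; exact: (integrableD measurableT (intc _ _ _) (intgG c)).
rewrite /= /stage_value mulr_sumr -(pair_big predT predT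
  (fun a x => \int[Q]_w f (a, x) w)) /=.
apply: eq_bigr => a _.
have QE x : fine (Q (hist_event t.+1 (rcons h.1 (h.2, a), x))) =
    fine (Q (hist_event t h)) * pi h a * P h (h.2, a, x).
  by rewrite probability_hist_step !fineM// ?fin_numM ?fin_num_measure//;
    exact: measurable_hist_event.
transitivity (\sum_x fine (Q (hist_event t h)) * pi h a * (P h (h.2, a, x) *
    (r h.2 a + gamma * horizon_value r gamma pi P n (rcons h.1 (h.2, a), x)))).
  apply: eq_bigr => x _; rewrite fE RintegralD//; last exact: intc.
  rewrite RintegralZl//.
  rewrite IH QE RintegralZr//=; last first.
    by have := intc (rcons h.1 (h.2, a), x) t.+1 1; under eq_fun do rewrite /= mulr1.
  rewrite {1}/Rintegral integral_indic//; last exact: measurable_hist_event.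
  by rewrite setIT QE; ring.
rewrite -mulr_sumr -mulrA; congr (_ * (_ * _)).
rewrite (eq_bigr (fun x => P h (h.2, a, x) * r h.2 a + gamma *
  (P h (h.2, a, x) * horizon_value r gamma pi P n (rcons h.1 (h.2, a), x)))); last first.
  by move=> x _; rewrite mulrDr (mulrCA gamma).
have [_ P1] := P_transition h h.2 a.
by rewrite big_split/= -mulr_suml -mulr_sumr P1 mul1r.
Qed.

Lemma expected_gain n : \int[Q]_w gain n 0 w = horizon_value r gamma pi P n ([::], s).
Proof.
transitivity (\int[Q]_w \sum_y (\1_(hist_event 0 ([::], y)) w * gain n 0 w)).
  apply: eq_Rintegral => w _; rewrite (bigD1 (X 0%N w))//= big1 => [|y ny].
    by rewrite addr0 indicE mem_set ?mul1r.
  by rewrite indicE memNset ?mul0r// => -[e]; rewrite e eqxx in ny.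
rewrite Rintegral_sum; last first.
  move=> y; exact: (integrable_indic_bounded (measurable_hist_event _ _)
    (measurable_gain n 0) (gain_norm_le n 0)).
have [mX _ Q0 _ _] := proc.
have E0 y : hist_event 0 ([::], y) = [set w | X 0%N w = y].
  by apply/seteqP; split=> w; rewrite /hist_event /history_at /=; [case|move=> ->].
rewrite (bigD1 s)//= big1 => [|y ny].
  by rewrite expected_gain_on_history E0 Q0 mul1r addr0.
rewrite expected_gain_on_history (_ : Q _ = 0%E) ?mul0r//; apply/eqP.
rewrite eq_le measure_ge0 andbT E0.
rewrite -(_ : Q (~` [set w | X 0%N w = s]) = 0%E); last first.
  by rewrite probability_setC ?Q0 ?subee.
by apply: le_measure; rewrite ?inE//; [exact: measurableC|move=> w /= -> /eqP; exact/negP].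
Qed.

(** The partial sums of the return are [gain n 0], uniformly bounded, so dominated
    convergence applies. *)
Lemma expected_discounted_return :
  exists2 v : R, ('E_Q[discounted_return r gamma X Y] = v%:E)%E &
    horizon_value r gamma pi P n ([::], s) @[n --> \oo] --> v.
Proof.
have cvg_gain w : gain n 0 w @[n --> \oo] --> discounted_return r gamma X Y w.
  rewrite (_ : (fun n => _) = series (fun t => gamma ^+ t * r (X t w) (Y t w))).
    apply: normed_cvg; apply: (series_le_cvg (v_ := geometric B gamma)) => [n|n|n|].
    - exact: normr_ge0.
    - by rewrite /= mulr_ge0 ?exprn_ge0// reward_bound_ge0.
    - by rewrite /= normrM normrX (ger0_norm gamma_ge0) mulrC ler_wpM2r ?exprn_ge0 ?reward_le_bound.
    - by apply: is_cvg_geometric_series; rewrite ger0_norm.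
  by apply/funext => n; rewrite gainE.
have mret : measurable_fun setT (discounted_return r gamma X Y).
  apply: (measurable_fun_cvg (h := fun n => gain n 0)) => [n|w _].
    exact: measurable_gain.
  exact: cvg_gain.
have [iret _ cvgE] := @dominated_convergence _ _ _ Q setT measurableT
  (fun n => EFin \o gain n 0) (EFin \o discounted_return r gamma X Y)
  (cst (B / (1 - gamma))%:E)
  (fun n => (measurable_EFinP _ _).2 (measurable_gain n 0))
  ((measurable_EFinP _ _).2 mret)
  (aeW _ (fun w _ => cvg_comp _ _ (cvg_gain w) (fun _ => id)))
  (finite_measure_integrable_cst _ _ measurableT)
  (aeW _ (fun w n _ => gain_norm_le n 0 w)).
have fret := integrable_fin_num measurableT iret.
exists (fine (\int[Q]_w (EFin \o discounted_return r gamma X Y) w)%E).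
  by rewrite unlock fineK.
rewrite -(fineK fret) in cvgE; move/fine_cvg: cvgE.
apply: cvg_trans; apply: near_eq_cvg; apply: nearW => n /=.
exact: expected_gain.
Qed.
End ProcessValue.

(** * Existence of controlled processes *)

Lemma measure_fibers {d} {T : measurableType d} {R : realType}
    (mu : {measure set T -> \bar R}) (I : finType) (E : set T) (g : T -> I) :
  (forall i, measurable (E `&` [set w | g w = i])) ->
  mu E = (\sum_i mu (E `&` [set w | g w = i]))%E.
Proof.
move=> mE; rewrite [in LHS](_ : E = \bigcup_i (E `&` [set w | g w = i])); last first.
  by apply/seteqP; split=> [w Ew|w [i _ []]//]; exists (g w).
rewrite measure_fin_bigcup//; last 2 first.
- exact: finite_finset.
- by move=> i j _ _ [w [[_ <-] [_ <-]]].
rewrite (fsbigE (index_enum I))// ?index_enum_uniq//.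
  by apply: eq_bigl => i; rewrite in_setT.
by move=> i _; rewrite mem_index_enum.
Qed.

Section SubdividedInterval.
(* Paths are lists with the most recent choice first, so that extending a path is a
   cons. The default choice [c0] is only made outside of the interval [0, 1). *)
Context {R : realType} {C : finType} (c0 : C) (q : seq C -> C -> R).
Hypothesis q_dist : forall l, is_dist (q l).

Definition mass_below (l : seq C) (k : nat) : R :=
  \sum_(c | (enum_rank c < k)%N) q l c.

Fixpoint cell_length (l : seq C) : R :=
  if l is c :: l' then cell_length l' * q l' c else 1.

(** The cell of a path is a subinterval of [0, 1): the cell of [l] is cut, from left
    to right along the enumeration of [C], into consecutive cells of the paths
    [c :: l] with lengths proportional to [q l c]. Reading the successive cells
    containing a uniform number then realizes the kernel [q]. *)
Fixpoint cell_start (l : seq C) : R :=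
  if l is c :: l' then cell_start l' + cell_length l' * mass_below l' (enum_rank c)
  else 0.

Definition in_cell (l : seq C) (w : R) : bool :=
  cell_start l <= w < cell_start l + cell_length l.

Lemma mass_belowS l c :
  mass_below l (enum_rank c).+1 = mass_below l (enum_rank c) + q l c.
Proof.
rewrite /mass_below (bigD1 c)//= addrC; congr (_ + _); apply: eq_bigl => c'.
by rewrite ltnS ltn_neqAle -(inj_eq enum_rank_inj c' c) andbC.
Qed.

Lemma le_mass_below l : {homo mass_below l : m n / (m <= n)%N >-> m <= n}.
Proof.
move=> m n mn; rewrite /mass_below big_mkcond [leRHS]big_mkcond.
apply: ler_sum => c _; have [q0 _] := q_dist l.
by case: ltnP => [cm|_]; [rewrite (leq_trans cm mn)|case: ifP].
Qed.

Lemma mass_below_full l : mass_below l #|C| = 1.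
Proof.
have [_ <-] := q_dist l; apply: eq_bigl => c; exact: ltn_ord.
Qed.

Lemma cell_length_ge0 l : 0 <= cell_length l.
Proof.
elim: l => [|c l IH] /=; first exact: ler01.
by have [q0 _] := q_dist l; rewrite mulr_ge0.
Qed.

Lemma cell_end_cons c l : cell_start (c :: l) + cell_length (c :: l) =
  cell_start l + cell_length l * mass_below l (enum_rank c).+1.
Proof. by rewrite mass_belowS /= mulrDr addrA. Qed.

Lemma in_cell_behead c l w : in_cell (c :: l) w -> in_cell l w.
Proof.
rewrite /in_cell cell_end_cons => /andP[lw wu]; apply/andP; split.
  apply: le_trans lw; rewrite /= lerDl mulr_ge0 ?cell_length_ge0//.
  by apply: sumr_ge0 => c' _; have [] := q_dist l.
apply: (lt_le_trans wu); rewrite lerD2l -[leRHS]mulr1.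
apply: ler_wpM2l; first exact: cell_length_ge0.
by rewrite -(mass_below_full l); apply: le_mass_below; exact: ltn_ord.
Qed.

Lemma in_cell_inj l w c c' : in_cell (c :: l) w -> in_cell (c' :: l) w -> c = c'.
Proof.
wlog lt_cc' : c c' / (enum_rank c <= enum_rank c')%N.
  move=> H; case: (leqP (enum_rank c) (enum_rank c')) => [|/ltnW] le h h'.
    exact: H.
  by apply/esym; exact: H.
move: lt_cc'; rewrite leq_eqVlt => /orP[/eqP/val_inj/enum_rank_inj//|lt_cc'].
rewrite /in_cell cell_end_cons => /andP[_ wu] /andP[/= lw _].
suff: w < w by rewrite ltxx.
apply: (lt_le_trans wu); apply: le_trans lw.
rewrite lerD2l ler_wpM2l ?cell_length_ge0//; exact: le_mass_below.
Qed.

(** The partial masses increase from 0 to 1, so some increment straddles the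
    relative position of [w]. *)
Lemma in_cell_child l w : in_cell l w -> exists c, in_cell (c :: l) w.
Proof.
move=> /andP[lw wu].
suff: forall k, (k <= #|C|)%N -> w < cell_start l + cell_length l * mass_below l k ->
    exists c, in_cell (c :: l) w.
  by apply; [exact: leqnn|rewrite mass_below_full mulr1].
elim=> [_|k IH kC wk].
  by rewrite /mass_below big_pred0// mulr0 addr0 ltNge lw.
have [|wk'] := ltP w (cell_start l + cell_length l * mass_below l k).
  by apply: IH; exact: ltnW.
exists (enum_val (Ordinal kC)).
by rewrite /in_cell cell_end_cons /= enum_valK wk'.
Qed.

Definition next_choice (l : seq C) (w : R) : C :=
  odflt c0 [pick c | in_cell (c :: l) w].

Fixpoint choices (t : nat) (w : R) : seq C :=
  if t is t'.+1 then next_choice (choices t' w) w :: choices t' w else [::].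

Lemma size_choices t w : size (choices t w) = t.
Proof. by elim: t => //= t ->. Qed.

Lemma next_choiceP l w c : in_cell (c :: l) w -> next_choice l w = c.
Proof.
move=> cw; rewrite /next_choice; case: pickP => [c' c'w|/(_ c)]; last by rewrite cw.
exact: in_cell_inj c'w cw.
Qed.

Lemma in_cell_choices t w : in_cell [::] w -> in_cell (choices t w) w.
Proof.
move=> w01; elim: t => //= t /in_cell_child[c cw].
by rewrite (next_choiceP _ _ _ cw).
Qed.

Lemma choices_in_cell l w : in_cell l w -> choices (size l) w = l.
Proof.
elim: l => //= c l IH cw; rewrite (IH (in_cell_behead _ _ _ cw)).
by rewrite (next_choiceP _ _ _ cw).
Qed.

Lemma choices_out t w : ~~ in_cell [::] w -> choices t w = nseq t c0.
Proof.
move=> w01.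
have out l : in_cell l w = false.
  by apply/negbTE; elim: l => //= c l; apply: contra; exact: in_cell_behead.
by elim: t => //= t ->; rewrite /next_choice; case: pickP => // c; rewrite out.
Qed.

Let Q : probability _ R := uniform_prob (@ltr01 R).

(** The second part is a null set; it only records that the choices are still
    defined outside of [0, 1). *)
Lemma choices_eventE t l : [set w | choices t w = l] =
  ([set w | (size l == t) && in_cell l w]) `|`
  ([set w | (nseq t c0 == l) && ~~ in_cell [::] w]).
Proof.
apply/seteqP; split=> w /=.
  move=> <-; rewrite size_choices eqxx.
  have [w01|w01] := boolP (in_cell [::] w); [left; exact: in_cell_choices|right].
  by rewrite choices_out ?eqxx.
by case=> /andP[/eqP <-]; [exact: choices_in_cell|exact: choices_out].
Qed.

Lemma in_cellE l : [set w | in_cell l w] =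
  [set` `[cell_start l, cell_start l + cell_length l[ ].
Proof. by apply/seteqP; split=> w; rewrite /= in_itv. Qed.

Lemma measurable_in_cell l : measurable [set w : R | in_cell l w].
Proof. by rewrite in_cellE; exact: measurable_itv. Qed.

Lemma measurable_out_cell : measurable [set w : R | ~~ in_cell [::] w].
Proof.
rewrite (_ : [set _ | _] = ~` [set w | in_cell [::] w]).
  by apply: measurableC; exact: measurable_in_cell.
by apply/seteqP; split=> w /= /negP.
Qed.

Lemma measurable_choices t l : measurable [set w | choices t w = l].
Proof.
rewrite choices_eventE; apply: measurableU.
  by case: (size l == t) => /=; [exact: measurable_in_cell|rewrite set_false].
by case: (_ == l) => /=; [exact: measurable_out_cell|rewrite set_false].
Qed.

Lemma probability_in_cell l : Q [set w | in_cell l w] = (cell_length l)%:E.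
Proof.
have cell01 w : in_cell l w -> 0 <= w <= 1.
  move=> lw; have: in_cell [::] w by elim: l lw => // c l IH /in_cell_behead.
  by rewrite /in_cell /= add0r => /andP[-> /ltW].
rewrite [LHS](_ : _ = \int[lebesgue_measure]_(w in [set w | in_cell l w]) (cst 1 w))%E.
  rewrite integral_cst ?mul1e; last exact: measurable_in_cell.
  have := lebesgue_measure_itv `[cell_start l, cell_start l + cell_length l[.
  rewrite -in_cellE => itvE; apply: (eq_trans itvE).
  rewrite /= lte_fin ltrDl -EFinB addrAC subrr add0r.
  by case: ltP => // l0; congr EFin; apply/eqP; rewrite eq_le l0 cell_length_ge0.
apply: eq_integral => w; rewrite inE /= => /cell01 w01.
by rewrite /uniform_pdf w01 subr0 invr1.
Qed.

Lemma probability_choices l : Q [set w | choices (size l) w = l] = (cell_length l)%:E.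
Proof.
have Qout : Q [set w : R | ~~ in_cell [::] w] = 0%E.
  rewrite (_ : [set _ | _] = ~` [set w | in_cell [::] w]); last first.
    by apply/seteqP; split=> w /= /negP.
  rewrite probability_setC; last exact: measurable_in_cell.
  by rewrite probability_in_cell /= subee.
rewrite choices_eventE eqxx /= -probability_in_cell.
apply/eqP; rewrite eq_le; apply/andP; split; last first.
  apply: le_measure; rewrite ?inE; first exact: measurable_in_cell.
    apply: measurableU; first exact: measurable_in_cell.
    by case: (_ == l) => /=; [exact: measurable_out_cell|rewrite set_false].
  by move=> w; left.
have -> : Q [set w | in_cell l w] =
    (Q [set w | in_cell l w] + Q [set w : R | ~~ in_cell [::] w])%E.
  by rewrite Qout adde0.
apply: (@le_trans _ _ (Q ([set w | in_cell l w] `|` [set w : R | ~~ in_cell [::] w]))).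
  apply: le_measure; rewrite ?inE.
  - apply: measurableU; first exact: measurable_in_cell.
    by case: (_ == l) => /=; [exact: measurable_out_cell|rewrite set_false].
  - by apply: measurableU; [exact: measurable_in_cell|exact: measurable_out_cell].
  - by move=> w [|/andP[_]]; [left|right].
by apply: measureU2; [exact: measurable_in_cell|exact: measurable_out_cell].
Qed.
End SubdividedInterval.

Section Existence.
Context {R : realType} {S A : finType}.
Context (pi : history S A -> A -> R) (P : history S A -> transition R S A) (s : S) (a0 : A).
Hypothesis pi_policy : policyH pi.
Hypothesis P_transition : forall h, is_transition (P h).

(** The choice at time [t] is the pair of the action [Y t] and the state [X t.+1]. *)
Fixpoint history_of (l : seq (A * S)) : history S A :=
  if l is c :: l' then (rcons (history_of l').1 ((history_of l').2, c.1), c.2)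
  else ([::], s).

Let q (l : seq (A * S)) (c : A * S) : R :=
  pi (history_of l) c.1 * P (history_of l) ((history_of l).2, c.1, c.2).

Let q_dist l : is_dist (q l).
Proof.
have [pi0 pi1] := pi_policy (history_of l).
split=> [[a x]|].
  by have [P0 _] := P_transition (history_of l) (history_of l).2 a; rewrite mulr_ge0.
rewrite -(pair_big predT predT (fun a x => q l (a, x))) /= -pi1.
apply: eq_bigr => a _; have [_ P1] := P_transition (history_of l) (history_of l).2 a.
by rewrite -[RHS]mulr1 -P1 mulr_sumr.
Qed.

Lemma history_of_inj : injective history_of.
Proof.
elim=> [|[a x] l IH] [|[a' x'] l'] //= -[].
- by case: (history_of l').1.
- by case: (history_of l).1.
move=> /rcons_inj[e1 e2 ->] ->; congr (_ :: _); apply: IH.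
by case: (history_of l) (history_of l') e1 e2 => ? ? [? ?] /= -> ->.
Qed.

Let Z := choices (a0, s) q.
Let X t w := (history_of (Z t w)).2.
Let Y t w := (next_choice (a0, s) q (Z t w) w).1.

Lemma history_at_choices t w : history_at X Y t w = history_of (Z t w).
Proof.
by elim: t => // t IH; rewrite history_atS IH.
Qed.

Let Q : probability _ R := uniform_prob (@ltr01 R).

Let mZ (f : nat -> set (seq (A * S))) t : measurable [set w | f t (Z t w)].
Proof.
rewrite (_ : [set _ | _] = \bigcup_(l in setT) ([set w | Z t w = l] `&` [set w | f t l])).
  apply: countable_bigcupT_measurable; first exact: countableP.
  move=> l; have [fl|nfl] := pselect (f t l).
    rewrite (_ : [set _ | f t l] = setT) ?setIT; first exact: measurable_choices.
    by apply/seteqP; split.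
  rewrite (_ : [set _ | f t l] = set0) ?setI0//.
  by apply/seteqP; split.
apply/seteqP; split=> w /=; first by exists (Z t w).
by case=> l _ [] /= ->.
Qed.

(** The interval is split along the kernel [q], the joint law of the next action and
    state given the past. Histories that do not start from [s] are never realized, and
    both sides of the required equations vanish for them. *)
Lemma controlled_process_exists : controlled_process pi P s Q X Y.
Proof.
(* By injectivity of [history_of], the event of a history is the event of a path. *)
have EZ t l : [set w | history_at X Y t w = history_of l] = [set w | Z t w = l].
  apply/seteqP; split=> w /=; rewrite history_at_choices; first exact: history_of_inj.
  by move=> ->.
have EZ' t l a x : [set w | [/\ history_at X Y t w = history_of l, Y t w = a & X t.+1 w = x]] =
    [set w | Z t.+1 w = (a, x) :: l].
  rewrite -EZ; apply/seteqP; split=> w /=.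
    by move=> ?; apply/history_atSP.
  by move/history_atSP.
have QZ t l a x : Q [set w | Z t.+1 w = (a, x) :: l] =
    (Q [set w | Z t w = l] * (pi (history_of l) a)%:E *
     (P (history_of l) ((history_of l).2, a, x))%:E)%E.
  (* A path whose length is not the time has probability 0. *)
  have [<-|nl] := eqVneq (size l) t.
    rewrite (probability_choices _ _ q_dist l).
    rewrite (probability_choices _ _ q_dist ((a, x) :: l)) /=.
    by rewrite -!EFinM mulrA.
  have emp t' l' : size l' != t' -> [set w | Z t' w = l'] = set0.
    move=> ne; apply/seteqP; split=> w //= e.
    by move: ne; rewrite -e size_choices eqxx.
  by rewrite !emp ?measure0 ?mul0e.
have none t h (E : set R) : ~ (exists l, history_of l = h) ->
    E `<=` [set w | history_at X Y t w = h] -> Q E = 0%E.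
  move=> nl sE; rewrite (_ : E = set0) ?measure0//; apply/seteqP; split=> w // /sE /=.
  by rewrite history_at_choices => e; apply: nl; exists (Z t w).
have mX t x : measurable [set w | X t w = x].
  exact: (mZ (fun t l => (history_of l).2 = x) t).
have mY t a : measurable [set w | Y t w = a].
  exact: (mZ (fun t l => (head (a0, s) l).1 = a) t.+1).
have HYX t h a : (Q [set w | history_at X Y t w = h /\ Y t w = a] =
        Q [set w | history_at X Y t w = h] * (pi h a)%:E)%E.
  have [[l <-]|nl] := pselect (exists l, history_of l = h); last first.
    by rewrite !(none t h _ nl) ?mul0e// => w [].
  have EZx x : [set w | history_at X Y t w = history_of l /\ Y t w = a] `&`
      [set w | X t.+1 w = x] = [set w | Z t.+1 w = (a, x) :: l].
    by rewrite -EZ'; apply/seteqP; split=> w [] // [].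
  transitivity (\sum_x (Q [set w | Z t w = l] * (pi (history_of l) a)%:E *
     (P (history_of l) ((history_of l).2, a, x))%:E))%E.
    under eq_bigr do rewrite -QZ -EZx.
    by apply: measure_fibers => x; rewrite EZx; exact: measurable_choices.
  have [P0 P1] := P_transition (history_of l) (history_of l).2 a.
  rewrite -ge0_sume_distrr => [|x _]; last by rewrite lee_fin.
  by rewrite sumEFin P1 mule1 EZ.
split=> // [|t h a x].
  rewrite (_ : [set _ | _] = setT) ?probability_setT//.
  by apply/seteqP; split.
rewrite HYX; have [[l <-]|nl] := pselect (exists l, history_of l = h).
  by rewrite EZ' QZ EZ.
by rewrite !(none t h _ nl) ?mul0e// => w [].
Qed.
End Existence.

(** The value is defined by a choice among the expectations over all realizations.
    There is a realization, and every one has the limit of the finite-horizon values as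
    its expectation, so the choice is this limit. *)
Lemma horizon_value_cvg {R : realType} {S A : finType} (r : S -> A -> R) (gamma : R)
    (pi : history S A -> A -> R) (P : history S A -> transition R S A) (s : S) :
  0 <= gamma -> gamma < 1 -> policyH pi -> (forall h, is_transition (P h)) ->
  horizon_value r gamma pi P n ([::], s) @[n --> \oo] --> value r gamma pi P s.
Proof.
move=> g0 g1 pi_policy P_transition.
have [a0] := is_dist_inhabited _ (pi_policy ([::], s)).
rewrite /value; set V := [set v : R | _].
have /getPex [d [T [Q [X [Y [proc]]]]]] : V !=set0.
  have proc := controlled_process_exists pi P s a0 pi_policy P_transition.
  have [v Ev _] := expected_discounted_return r gamma pi P s _ _ _ P_transition proc g0 g1.
  by exists v; do 5 eexists; split; [exact: proc|rewrite Ev].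
have [v -> cvgv] := expected_discounted_return r gamma pi P s _ _ _ P_transition proc g0 g1.
by move=> [->].
Qed.

(** * A theorem of the alternative on compact convex sets *)

Lemma continuous_sum {R : realType} {T : topologicalType} {I : finType} (f : I -> T -> R) :
  (forall i, continuous (f i)) -> continuous (fun x => \sum_i f i x).
Proof.
move=> cf x; apply: (cvg_big (op := +%R)) => [|i _].
  exact: add_continuous.
exact: cf.
Qed.

Lemma compact_attains_min {R : realType} {T : topologicalType} (K : set T) (f : T -> R) :
  K !=set0 -> compact K -> {within K, continuous f} ->
  exists2 x, K x & forall y, K y -> f x <= f y.
Proof.
move=> K0 cK cf; have [x Kx xmin] := compact_EVT_min K0 cK cf.
exists x; first exact: set_mem.
by move=> y Ky; apply: xmin; rewrite inE.
Qed.

(** Minimize the sum of the squared positive parts over the compact set. If the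
    minimum [G] is positive, take the positive parts at the minimizer [x] as weights; a
    point [y] that is nonpositive for the weighted sum gives a direction of descent:
    the sum of squares at the point of parameter [t] on the way from [x] to [y] is at
    most [(1 - t)^2 * G + t^2 * H], where [H] is the sum of the squares at [y], because
    the mixed term is nonpositive. *)
Lemma convexlike_alternative {R : realType} {T : topologicalType} {I : finType}
    (K : set T) (L : I -> T -> R) :
  K !=set0 -> compact K -> (forall i, continuous (L i)) ->
  (forall x y t, K x -> K y -> 0 <= t <= 1 ->
     exists2 z, K z & forall i, L i z <= (1 - t) * L i x + t * L i y) ->
  (forall lambda : I -> R, (forall i, 0 <= lambda i) ->
     exists2 x, K x & \sum_i lambda i * L i x <= 0) ->
  exists2 x, K x & forall i, L i x <= 0.
Proof.
move=> K0 cK cL Kconv Klambda.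
pose excess i x := Num.max 0 (L i x).
have excess_ge0 i x : 0 <= excess i x by rewrite le_max lexx.
have cexcess : continuous (fun x => \sum_i excess i x ^+ 2).
  apply: continuous_sum => i x.
  apply: (@cvg_comp _ _ _ (excess i) (fun y => y ^+ 2)).
    by apply: (@continuous_max _ _ (cst 0) (L i)); [exact: cvg_cst|exact: cL].
  exact: exprn_continuous.
have [x Kx xmin] := compact_attains_min _ _ K0 cK (continuous_subspaceT cexcess).
have [y Ky ynonpos] := Klambda (excess ^~ x) (excess_ge0 ^~ x).
pose G := \sum_i excess i x ^+ 2; pose H := \sum_i L i y ^+ 2.
have G0 : 0 <= G by apply: sumr_ge0 => i _; exact: sqr_ge0.
have H0 : 0 <= H by apply: sumr_ge0 => i _; exact: sqr_ge0.
have GH t : 0 <= t <= 1 -> G <= (1 - t) ^+ 2 * G + t ^+ 2 * H.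
  move=> t01; have [z Kz zL] := Kconv x y t Kx Ky t01.
  have /andP[t0 t1] := t01.
  apply: (le_trans (xmin z Kz)).
  apply: (@le_trans _ _ (\sum_i ((1 - t) * excess i x + t * L i y) ^+ 2)).
    apply: ler_sum => i _; rewrite {1}/excess; case: (leP (L i z) 0) => [|Lz0].
      by move=> _; rewrite expr0n /= sqr_ge0.
    have Lz : L i z <= (1 - t) * excess i x + t * L i y.
      apply: (le_trans (zL i)); rewrite lerD2r ler_wpM2l ?subr_ge0//.
      by rewrite /excess le_max lexx orbT.
    by rewrite ler_sqr ?nnegrE ?(le_trans (ltW Lz0)) ?(ltW Lz0).
  apply: (@le_trans _ _ ((1 - t) ^+ 2 * G + t ^+ 2 * H +
      2 * t * (1 - t) * \sum_i excess i x * L i y)).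
    rewrite /G /H !mulr_sumr -!big_split/=; apply: ler_sum => i _; nra.
  rewrite gerDl; apply: mulr_ge0_le0 => //.
  by rewrite !mulr_ge0 ?subr_ge0.
have G_eq0 : G = 0.
  apply/eqP; rewrite eq_le G0 andbT leNgt; apply/negP => Gpos.
  have GHpos : 0 < G + H by lra.
  (* The minimizer of the quadratic bound; there the bound is [G * H / (G + H) < G]. *)
  have := GH (G / (G + H)).
  rewrite divr_ge0 ?(ltW GHpos)// ler_pdivrMr// mul1r lerDl H0 => /(_ isT).
  set t := G / (G + H) => Gt.
  have tpos : 0 < t by rewrite divr_gt0.
  have tGH : t * (G + H) = G by rewrite divfK ?gt_eqF.
  nra.
exists x => // i.
have : excess i x ^+ 2 <= 0.
  rewrite -G_eq0 /G (bigD1 i)//= lerDl; apply: sumr_ge0 => j _; exact: sqr_ge0.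
rewrite exprn_even_le0//= => /eqP e.
by rewrite -e /excess le_max lexx orbT.
Qed.

(** * One-step bounds and continuity of the value *)

Lemma value_ge {R : realType} {S A : finType} (r : S -> A -> R) (gamma : R)
    (pi : history S A -> A -> R) (P : history S A -> transition R S A) (w : S -> R) :
  0 <= gamma -> gamma < 1 -> policyH pi -> (forall h, is_transition (P h)) ->
  (forall h, w h.2 <= stage_value r gamma h.2 (pi h) (P h) (fun=> w)) ->
  forall s, w s <= value r gamma pi P s.
Proof.
move=> g0 g1 pi_policy P_transition Tw s.
pose C := \sum_x `|w x|.
have wC x : w x <= C.
  by rewrite (le_trans (ler_norm _))// /C (bigD1 x)//= lerDl sumr_ge0.
have cvg1 : (w s - gamma ^+ n * C) @[n --> \oo] --> w s.
  rewrite -[X in _ --> X]subr0 -[X in _ --> _ - X](mul0r C).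
  by apply: cvgB; [exact: cvg_cst|apply: cvgMr_tmp; apply: cvg_expr; rewrite ger0_norm].
apply: (ler_cvg_to cvg1 (horizon_value_cvg r gamma pi P s g0 g1 pi_policy P_transition)).
by apply: nearW => n; exact: (horizon_value_ge r gamma pi P g0 pi_policy P_transition w C wC Tw n ([::], s)).
Qed.

Lemma value_le {R : realType} {S A : finType} (r : S -> A -> R) (gamma : R)
    (pi : history S A -> A -> R) (P : history S A -> transition R S A) (w : S -> R) :
  0 <= gamma -> gamma < 1 -> policyH pi -> (forall h, is_transition (P h)) ->
  (forall h, stage_value r gamma h.2 (pi h) (P h) (fun=> w) <= w h.2) ->
  forall s, value r gamma pi P s <= w s.
Proof.
move=> g0 g1 pi_policy P_transition Tw s.
pose C := \sum_x `|w x|.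
have wC x : - C <= w x.
  rewrite lerNl (le_trans (ler_norm _))// normrN.
  by rewrite /C (bigD1 x)//= lerDl sumr_ge0.
have cvg1 : (w s + gamma ^+ n * C) @[n --> \oo] --> w s.
  rewrite -[X in _ --> X]addr0 -[X in _ --> _ + X](mul0r C).
  by apply: cvgD; [exact: cvg_cst|apply: cvgMr_tmp; apply: cvg_expr; rewrite ger0_norm].
apply: (ler_cvg_to (horizon_value_cvg r gamma pi P s g0 g1 pi_policy P_transition) cvg1).
by apply: nearW => n; exact: (horizon_value_le r gamma pi P g0 pi_policy P_transition w C wC Tw n ([::], s)).
Qed.

Lemma continuous_action_value {R : realType} {S A : finType} (r : S -> A -> R) (gamma : R)
    (s : S) (a : A) (v : S -> transition R S A -> R) :
  (forall x, continuous (v x)) ->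
  continuous (fun P : transition R S A => r s a + gamma * \sum_x P (s, a, x) * v x P).
Proof.
move=> cv.
have cP x : continuous (fun P : transition R S A => P (s, a, x)).
  exact: (@proj_continuous (S * A * S)%type (fun=> R) (s, a, x)).
have cM x : continuous (fun P : transition R S A => P (s, a, x) * v x P).
  by move=> P; exact: cvgM (cP x P) (cv x P).
have cS : continuous (fun P : transition R S A => \sum_x P (s, a, x) * v x P).
  exact: continuous_sum cM.
have cG : continuous (fun P : transition R S A => gamma * \sum_x P (s, a, x) * v x P).
  by move=> P; exact: cvgMl_tmp (cS P).
by move=> P; exact: cvgD (cvg_cst _) (cG P).
Qed.

Lemma continuous_stage_value {R : realType} {S A : finType} (r : S -> A -> R) (gamma : R)
    (s : S) (p : A -> R) (v : A -> S -> transition R S A -> R) :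
  (forall a x, continuous (v a x)) ->
  continuous (fun P => stage_value r gamma s p P (fun a x => v a x P)).
Proof.
move=> cv.
have cQ a : continuous (fun P : transition R S A =>
    p a * (r s a + gamma * \sum_x P (s, a, x) * v a x P)).
  by move=> P; exact: cvgMl_tmp (continuous_action_value r gamma s a (v a) (cv a) P).
exact: continuous_sum cQ.
Qed.

Lemma continuous_horizon_value {R : realType} {S A : finType} (r : S -> A -> R) (gamma : R)
    (pi : history S A -> A -> R) n h :
  continuous (fun P : transition R S A => horizon_value r gamma pi (cst P) n h).
Proof.
elim: n h => [|n IH] h; first exact: (@cst_continuous (transition R S A) R 0).
exact: (continuous_stage_value r gamma h.2 (pi h)
  (fun a x P => horizon_value r gamma pi (cst P) n (rcons h.1 (h.2, a), x)) (fun a x => IH _)).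
Qed.

Lemma within_continuous_uniform_limit {R : realType} {T : topologicalType} (K : set T)
    (f_ : nat -> T -> R) (f : T -> R) (e : nat -> R) :
  (forall n, continuous (f_ n)) -> e @ \oo --> 0 ->
  (forall n x, K x -> `|f x - f_ n x| <= e n) ->
  {within K, continuous f}.
Proof.
move=> cf e0 fe; apply/subspace_continuousP => x Kx.
apply/cvgrPdist_le => eps eps0.
have eps3 : 0 < eps / 3 by rewrite divr_gt0.
have [n _ /(_ n (leqnn n)) /= en] : \forall n \near \oo, `|0 - e n| <= eps / 3.
  by move/cvgrPdist_le: e0 => /(_ _ eps3).
have {}en : e n <= eps / 3 by rewrite (le_trans _ en)// sub0r normrN ler_norm.
have := cf n x; move/cvgrPdist_le => /(_ _ eps3) cfn.
rewrite near_withinE; apply: filterS cfn => y fnxy Ky.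
have := fe n x Kx; have := fe n y Ky; move: fnxy.
rewrite !ler_norml => /andP[? ?] /andP[? ?] /andP[? ?]; rewrite /from_subspace; apply/andP; split; lra.
Qed.

(** Finite-horizon values are polynomials in the kernel and converge uniformly. *)
Lemma continuous_value {R : realType} {S A : finType} (U : set (transition R S A))
    (r : S -> A -> R) (gamma : R) (pi : history S A -> A -> R) (s : S) :
  0 <= gamma -> gamma < 1 -> policyH pi -> (forall P, U P -> is_transition P) ->
  {within U, continuous (fun P => value r gamma pi (cst P) s)}.
Proof.
move=> g0 g1 pi_policy U_transition.
pose B := reward_bound r.
have W_value n P : U P ->
    `|value r gamma pi (cst P) s - horizon_value r gamma pi (cst P) n ([::], s)| <=
    gamma ^+ n * (B / (1 - gamma)).
  move=> UP; have P_transition (h : history S A) : is_transition (cst P h) by exact: U_transition.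
  have cvgW := horizon_value_cvg r gamma pi (cst P) s g0 g1 pi_policy P_transition.
  have cvgN : `|horizon_value r gamma pi (cst P) k ([::], s) -
      horizon_value r gamma pi (cst P) n ([::], s)| @[k --> \oo] -->
      `|value r gamma pi (cst P) s - horizon_value r gamma pi (cst P) n ([::], s)|.
    by apply: cvg_norm; apply: cvgB => //; exact: cvg_cst.
  apply: (ler_cvg_to cvgN (cvg_cst _)); exists n => // k /= nk.
  rewrite -(subnKC nk).
  exact: (horizon_value_dist_le r gamma pi (cst P) g0 pi_policy P_transition g1).
apply: (within_continuous_uniform_limit U
  (fun n P => horizon_value r gamma pi (cst P) n ([::], s)) _
  (fun n => gamma ^+ n * (B / (1 - gamma)))) => [n||n P UP].
- exact: continuous_horizon_value.
- rewrite -[X in _ --> X](mul0r (B / (1 - gamma))).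
  by apply: cvgMr_tmp; apply: cvg_expr; rewrite ger0_norm.
- exact: W_value.
Qed.

(** * The robust one-step operator and its fixed point *)

Lemma stage_value_shift {R : realType} {S A : finType} (r : S -> A -> R) (gamma : R)
    (c : S -> R) (s : S) (p : A -> R) (P : transition R S A) (v : A -> S -> R) :
  is_dist p ->
  stage_value (fun s a => r s a + c s) gamma s p P v = stage_value r gamma s p P v + c s.
Proof.
move=> [_ p1]; rewrite -[c s in RHS]mul1r -p1 mulr_suml -big_split/=.
by apply: eq_bigr => a _; rewrite -mulrDr addrAC.
Qed.

(** The worst one-step value when the adversary sees the current state and the mixed
    action [p]; by compactness the infimum is a minimum. *)
Definition robust_stage {R : realType} {S A : finType} (U : set (transition R S A))
    (r : S -> A -> R) (gamma : R) (s : S) (p : A -> R) (v : S -> R) : R :=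
  inf [set stage_value r gamma s p P (fun=> v) | P in U].

Section RobustFixpoint.
Context {R : realType} {S A : finType} (U : set (transition R S A)).
Context (r : S -> A -> R) (gamma : R).
Hypothesis U_transition : forall P, U P -> is_transition P.
Hypothesis U_nonempty : U !=set0.
Hypothesis U_compact : compact U.
Hypothesis gamma_ge0 : 0 <= gamma.
Hypothesis gamma_lt1 : gamma < 1.

Lemma robust_stage_is_min s p v :
  is_min [set stage_value r gamma s p P (fun=> v) | P in U] (robust_stage U r gamma s p v).
Proof.
have cst_v (a : A) x : continuous ((fun=> v x) : transition R S A -> R).
  exact: (@cst_continuous (transition R S A) R (v x)).
have [P UP Pmin] := compact_attains_min U _ U_nonempty U_compact
  (continuous_subspaceT (continuous_stage_value r gamma s p (fun _ x _ => v x) cst_v)).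
have lbP : lbound [set stage_value r gamma s p P (fun=> v) | P in U]
    (stage_value r gamma s p P (fun=> v)).
  by move=> _ [P' UP' <-]; exact: Pmin.
have -> : robust_stage U r gamma s p v = stage_value r gamma s p P (fun=> v).
  apply/eqP; rewrite eq_le; apply/andP; split.
    by apply: ge_inf; [exists (stage_value r gamma s p P (fun=> v))|exists P].
  by apply: lb_le_inf => //; exists (stage_value r gamma s p P (fun=> v)); exists P.
by split=> //; exists P.
Qed.

Lemma robust_stage_le s p P v : U P ->
  robust_stage U r gamma s p v <= stage_value r gamma s p P (fun=> v).
Proof. by move=> UP; apply: (robust_stage_is_min s p v).2; exists P. Qed.

Lemma robust_stage_mono s p v w : is_dist p -> (forall x, v x <= w x) ->
  robust_stage U r gamma s p v <= robust_stage U r gamma s p w.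
Proof.
move=> dp vw; have [[P UP <-] _] := robust_stage_is_min s p w.
apply: (le_trans (robust_stage_le s p P v UP)).
rewrite -[leRHS]addr0 -(mulr0 gamma); apply: stage_value_le => //; first exact: U_transition.
by move=> _ x; rewrite addr0.
Qed.

(** Named after the one-step max-min equation of the s-rectangular game, whose least
    supersolution is the value of that game. *)
Definition supersolution (v : S -> R) : Prop :=
  forall s p, is_dist p -> robust_stage U r gamma s p v <= v s.

Let B := reward_bound r.

Lemma supersolution_const : supersolution (fun=> B / (1 - gamma)).
Proof.
have g1 : 1 - gamma != 0 by rewrite subr_eq0 gt_eqF.
move=> s p dp; have [P UP] := U_nonempty.
apply: (le_trans (robust_stage_le s p P _ UP)).
apply: is_dist_sum_le => // a; have [_ P1] := U_transition P UP s a.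
rewrite -mulr_suml P1 mul1r.
have fixB : B / (1 - gamma) = B + gamma * (B / (1 - gamma)) by field.
by rewrite [leRHS]fixB lerD2r (le_trans (ler_norm _))// reward_le_bound.
Qed.

(** Look at a state where [v] is minimal. *)
Lemma supersolution_ge (a0 : A) v s : supersolution v -> - (B / (1 - gamma)) <= v s.
Proof.
move=> vsup.
have g1 : 0 < 1 - gamma by rewrite subr_gt0.
have [s0 _ s0min] := @arg_minP _ R S s predT v isT.
apply: le_trans (s0min s isT).
pose p a : R := (a == a0)%:R.
have dp : is_dist p by exact: is_dist_dirac.
have [[P UP eP] _] := robust_stage_is_min s0 p v.
have := vsup s0 p dp; rewrite -eP => le_v.
have : - B + gamma * v s0 <= v s0.
  apply: le_trans le_v; apply: is_dist_sum_ge => // a; apply: lerD.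
    by have := reward_le_bound r s0 a; rewrite ler_norml => /andP[].
  apply: ler_wpM2l => //; apply: is_dist_sum_ge; first exact: U_transition.
  by move=> x; exact: s0min.
rewrite -mulNr ler_pdivrMr//; lra.
Qed.

(** The value of the s-rectangular game as a least fixed point: the pointwise infimum
    of the supersolutions is a supersolution by monotonicity. It is also a subsolution up
    to any error, for otherwise lowering it at one state would give a smaller
    supersolution. *)
Lemma robust_fixpoint (a0 : A) : exists2 v : S -> R, supersolution v &
  forall s eps, 0 < eps -> exists2 p, is_dist p & v s - eps < robust_stage U r gamma s p v.
Proof.
pose v s := inf [set w s | w in supersolution].
have lb s : has_lbound [set w s | w in supersolution].
  by exists (- (B / (1 - gamma))) => _ [w wsup <-]; exact: supersolution_ge.
have v_le w s : supersolution w -> v s <= w s by move=> wsup; apply: ge_inf => //; exists w.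
have vsup : supersolution v.
  move=> s p dp; apply: lb_le_inf.
    by exists (B / (1 - gamma)); exists (fun=> B / (1 - gamma)); first exact: supersolution_const.
  move=> _ [w wsup <-]; apply: le_trans (wsup s p dp).
  by apply: robust_stage_mono => // x; exact: v_le.
exists v => // s eps eps0; apply: contrapT => none.
pose w x := if x == s then v s - eps else v x.
have wv x : w x <= v x.
  by rewrite /w; case: eqP => [->|//]; rewrite gerBl ltW.
have wsup : supersolution w.
  move=> x p dp; apply: (le_trans (robust_stage_mono x p w v dp wv)).
  rewrite /w; case: eqP => [->|_]; last exact: vsup.
  by rewrite leNgt; apply/negP => lt_v; apply: none; exists p.
by have := v_le w s wsup; rewrite /w eqxx lerBrDr gerDl leNgt eps0.
Qed.
End RobustFixpoint.

(** Tractability lets one kernel minimize the one-step values at all states at once,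
    for an arbitrary continuation [v]: shifting the rewards by a function of the state
    makes [v] the robust value of [pi], and under the uniform initial distribution a
    kernel attaining the minimum has to be optimal at every state. *)
Lemma tractable_minimizer {R : realType} {S A : finType} (U : set (transition R S A))
    (r : S -> A -> R) (gamma : R) (pi : S -> A -> R) (v : S -> R) :
  (0 < #|S|)%N -> (forall P, U P -> is_transition P) -> U !=set0 -> compact U ->
  weakly_s_tractable U -> 0 <= gamma < 1 -> policyS pi ->
  exists2 P, U P & forall s,
    stage_value r gamma s (pi s) P (fun=> v) = robust_stage U r gamma s (pi s) v.
Proof.
move=> hS U_transition U_nonempty U_compact U_tractable g01 pi_policy.
have /andP[g0 g1] := g01.
have min_s s := robust_stage_is_min U r gamma U_nonempty U_compact s (pi s) v.
pose r' s a := r s a + (v s - robust_stage U r gamma s (pi s) v).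
have shift s P : stage_value r' gamma s (pi s) P (fun=> v) =
    stage_value r gamma s (pi s) P (fun=> v) + (v s - robust_stage U r gamma s (pi s) v).
  exact: stage_value_shift.
have v_robust : is_robust_value U r' gamma pi v.
  move=> s; have [[P UP eP] lbP] := min_s s; split.
    by exists P => //; rewrite -/(stage_value r' gamma s (pi s) P (fun=> v)) shift eP subrKC.
  move=> _ [P' UP' <-]; rewrite -/(stage_value r' gamma s (pi s) P' (fun=> v)) shift.
  rewrite addrCA lerDl subr_ge0; apply: lbP; by exists P'.
pose mu (s : S) : R := #|S|%:R^-1.
have mu_gt0 s : 0 < mu s by rewrite invr_gt0 ltr0n.
have mu_dist : is_dist mu.
  split=> [s|]; first exact: ltW.
  by rewrite sumr_const -[LHS]mulr_natr mulVf// pnatr_eq0 -lt0n.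
have [[P UP eP] _] := U_tractable pi r' gamma mu v pi_policy g01 mu_dist v_robust.
exists P => // s.
have piH : policyH (stationary pi) by move=> h; exact: pi_policy.
have Pt (h : history S A) : is_transition (cst P h) by exact: U_transition.
pose Tv s := stage_value r' gamma s (pi s) P (fun=> v).
have v_Tv x : v x <= Tv x.
  by have [_ lb] := v_robust x; apply: lb; exists P.
(* [v <= Tv] makes [Tv] a subsolution as well, so the value lies above [Tv], and not
   only above [v]; equality of the averages then forces [Tv = v]. *)
have Tv_value x : Tv x <= value r' gamma (stationary pi) (cst P) x.
  apply: value_ge => // h; rewrite -[leRHS]addr0 -(mulr0 gamma).
  apply: stage_value_le; [exact: g0|exact: pi_policy|exact: U_transition|].
  by move=> a y; rewrite addr0.
have Tv_eq : Tv s = v s.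
  apply/eqP; rewrite eq_le v_Tv andbT.
  have : \sum_x mu x * (value r' gamma (stationary pi) (cst P) x - v x) = 0.
    under eq_bigr do rewrite mulrBr.
    by rewrite sumrB -eP subrr.
  move/eqP; rewrite psumr_eq0 => [/allP/(_ s)|x _]; last first.
    by rewrite mulr_ge0 ?(ltW (mu_gt0 x))// subr_ge0 (le_trans (v_Tv x)).
  rewrite mem_index_enum => /(_ isT); rewrite mulf_eq0 gt_eqF//= subr_eq0 => /eqP <-.
  exact: Tv_value.
by move: Tv_eq; rewrite /Tv shift; lra.
Qed.

(** * The saddle point and the theorem *)

(** One kernel that is a best reply in all states and against all actions. By the
    alternative it suffices to treat one weighted sum of the inequalities; normalizing
    the weights at each state turns them into a stationary policy, for which the
    tractable minimizer does the job. *)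
Lemma saddle_kernel {R : realType} {S A : finType} (U : set (transition R S A))
    (r : S -> A -> R) (gamma : R) (v : S -> R) :
  (0 < #|S|)%N -> (0 < #|A|)%N -> (forall P, U P -> is_transition P) ->
  U !=set0 -> compact U -> @convex_set R (S * A * S -> R^o) U ->
  weakly_s_tractable U -> 0 <= gamma < 1 -> supersolution U r gamma v ->
  exists2 P, U P & forall s a, r s a + gamma * \sum_x P (s, a, x) * v x <= v s.
Proof.
move=> hS /card_gt0P[a0 _] U_transition U_nonempty U_compact U_convex U_tractable g01 vsup.
pose L (c : S * A) (P : transition R S A) : R :=
  r c.1 c.2 + gamma * \sum_x P (c.1, c.2, x) * v x - v c.1.
suff [P UP LP] : exists2 P, U P & forall c, L c P <= 0.
  by exists P => // s a; have := LP (s, a); rewrite /L subr_le0.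
apply: convexlike_alternative => //.
- move=> [s a].
  have cst_v x : continuous ((fun=> v x) : transition R S A -> R).
    exact: (@cst_continuous (transition R S A) R (v x)).
  move=> P; exact: cvgB (continuous_action_value r gamma s a (fun x _ => v x) cst_v P) (cvg_cst _).
- move=> P P' t UP UP' /andP[t0 t1].
  have := U_convex P' P (Itv01 t0 t1); rewrite !inE => /(_ UP' UP) UZ.
  exists (fun c => t * P' c + (1 - t) * P c); first exact: UZ.
  move=> [s a]; rewrite /L /= le_eqVlt; apply/orP; left; apply/eqP.
  have -> : \sum_x (t * P' (s, a, x) + (1 - t) * P (s, a, x)) * v x =
      t * (\sum_x P' (s, a, x) * v x) + (1 - t) * (\sum_x P (s, a, x) * v x).
    by rewrite !mulr_sumr -big_split; apply: eq_bigr => x _; rewrite mulrDl -!mulrA.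
  ring.
move=> lambda lambda0.
pose tot s := \sum_a lambda (s, a).
(* At a state of total weight 0 any mixed action will do. *)
pose pi s a : R := if tot s == 0 then (a == a0)%:R else lambda (s, a) / tot s.
have tot_ge0 s : 0 <= tot s by exact: sumr_ge0.
have pi_policy : policyS pi.
  move=> s; rewrite /pi; have [_|tot0] := eqVneq (tot s) 0; first exact: is_dist_dirac.
  by split=> [a|]; rewrite ?divr_ge0// -mulr_suml mulfV.
have lambdaE s a : lambda (s, a) = tot s * pi s a.
  rewrite /pi; have [tot0|tot0] := eqVneq (tot s) 0; last by rewrite mulrC divfK.
  rewrite tot0 mul0r; apply/eqP; move/eqP: tot0.
  by rewrite psumr_eq0// => /allP/(_ a); rewrite mem_index_enum => /(_ isT).
have [P UP eP] := tractable_minimizer U r gamma pi v hS U_transition U_nonempty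
  U_compact U_tractable g01 pi_policy.
exists P => //.
rewrite (eq_bigr (fun c => lambda (c.1, c.2) * L (c.1, c.2) P)); last by case.
rewrite -(pair_big predT predT (fun s a => lambda (s, a) * L (s, a) P)) /=.
apply: sumr_le0 => s _.
have -> : \sum_a lambda (s, a) * L (s, a) P =
    tot s * (stage_value r gamma s (pi s) P (fun=> v) - v s).
  have [_ pi1] := pi_policy s.
  have -> : v s = \sum_a pi s a * v s by rewrite -mulr_suml pi1 mul1r.
  rewrite -sumrB mulr_sumr; apply: eq_bigr => a _.
  by rewrite lambdaE -mulrA -mulrBr.
rewrite mulr_ge0_le0// subr_le0 eP; exact: vsup.
Qed.

(** An error [eps * (1 - gamma)] made at every step accumulates to [eps]. *)
Lemma value_eps_optimal {R : realType} {S A : finType} (U : set (transition R S A))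
    (r : S -> A -> R) (gamma : R) (v : S -> R) (eps : R) :
  (forall P, U P -> is_transition P) -> U !=set0 -> compact U ->
  0 <= gamma -> gamma < 1 -> 0 < eps ->
  (forall s eps, 0 < eps -> exists2 p, is_dist p & v s - eps < robust_stage U r gamma s p v) ->
  exists2 pi : S -> A -> R, policyS pi &
    forall P, adversaryH U P -> forall s, v s - eps <= value r gamma (stationary pi) P s.
Proof.
move=> U_transition U_nonempty U_compact g0 g1 eps0 v_sub.
have eps1 : 0 < eps * (1 - gamma) by rewrite mulr_gt0// subr_gt0.
have {}v_sub s : exists p, is_dist p /\ v s - eps * (1 - gamma) < robust_stage U r gamma s p v.
  by have [p dp vp] := v_sub s _ eps1; exists p.
have [pi piP] := choice v_sub.
have pi_policy : policyS pi by move=> s; have [] := piP s.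
exists pi => // P UP s.
(* [v - eps] is a subsolution against every adversary. *)
apply: (value_ge r gamma (stationary pi) P (fun s => v s - eps)) => //.
- by move=> h; exact: pi_policy.
- by move=> h; exact: U_transition.
move=> h; have [dp vp] := piP h.2.
have := robust_stage_le U r gamma U_nonempty U_compact h.2 (pi h.2) (P h) v (UP h).
have : stage_value r gamma h.2 (pi h.2) (P h) (fun=> v) <=
    stage_value r gamma h.2 (pi h.2) (P h) (fun _ s => v s - eps) + gamma * eps.
  apply: stage_value_le; [exact: g0|exact: pi_policy|exact: U_transition|].
  by move=> a x; rewrite subrK.
move: vp; rewrite /stationary; lra.
Qed.

Theorem theorem9 (R : realType) (S A : finType) (hS : (0 < #|S|)%N) (hA : (0 < #|A|)%N)
    (U : set (transition R S A)) (U_transition : forall P, U P -> is_transition P)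
    (U_nonempty : U !=set0) (U_compact : compact U)
    (U_convex : @convex_set R (S * A * S -> R^o) U)
    (U_tractable : weakly_s_tractable U)
    (r : S -> A -> R) (gamma : R) (hgamma : 0 < gamma < 1)
    (mu : S -> R) (hmu : is_dist mu) :
  (forall pi : history S A -> A -> R, policyH pi ->
     exists m, is_min [set avg_value r gamma mu pi (cst P) | P in U] m) /\
  ereal_sup [set ereal_inf [set (avg_value r gamma mu pi P)%:E
                           | P in adversaryH U]
            | pi in @policyH R S A] =
  ereal_sup [set ereal_inf [set (avg_value r gamma mu pi (cst P))%:E
                           | P in U]
            | pi in @policyH R S A].
Proof.
have /andP[/ltW g0 g1] := hgamma.
have g01 : 0 <= gamma < 1 by rewrite g0.
split=> [pi pi_policy|].
  have cavg : {within U, continuous (fun P => avg_value r gamma mu pi (cst P))}.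
    have cs s : {within U, continuous (fun P => mu s * value r gamma pi (cst P) s)}.
      move=> P; exact: cvgMl_tmp (continuous_value U r gamma pi s g0 g1 pi_policy U_transition P).
    exact: continuous_sum cs.
  have [P UP Pmin] := compact_attains_min U _ U_nonempty U_compact cavg.
  exists (avg_value r gamma mu pi (cst P)); split; first by exists P.
  by move=> _ [P' UP' <-]; exact: Pmin.
have /card_gt0P[a0 _] := hA.
have [v vsup vsub] :=
  robust_fixpoint U r gamma U_transition U_nonempty U_compact g0 g1 a0.
have [mu0 _] := hmu.
apply/eqP; rewrite eq_le; apply/andP; split.
  apply: ge_ereal_sup => _ [pi pi_policy <-].
  apply: (@le_trans _ _ (ereal_inf [set (avg_value r gamma mu pi (cst P))%:E | P in U])).
    by apply: ereal_inf_le_tmp => _ [P UP <-]; exists (cst P) => // h.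
  by apply: ereal_sup_ubound; exists pi.
(* The average of the game value [v] lies between the two suprema. *)
apply: (@le_trans _ _ (\sum_s mu s * v s)%:E).
  have [P UP Pv] := saddle_kernel U r gamma v hS hA U_transition U_nonempty U_compact
    U_convex U_tractable g01 vsup.
  apply: ge_ereal_sup => _ [pi pi_policy <-].
  apply: (@le_trans _ _ (avg_value r gamma mu pi (cst P))%:E).
    by apply: ereal_inf_lbound; exists P.
  rewrite lee_fin; apply: ler_sum => s _; apply: ler_wpM2l => //.
  apply: value_le => //; first by move=> h; exact: U_transition.
  by move=> h; apply: is_dist_sum_le => // a; exact: Pv.
apply/lee_addgt0Pr => eps eps0.
have [pi pi_policy piv] := value_eps_optimal U r gamma v eps U_transition U_nonempty
  U_compact g0 g1 eps0 vsub.
rewrite -leeBlDr// -EFinB.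
apply: (@le_trans _ _ (ereal_inf [set (avg_value r gamma mu (stationary pi) P)%:E
                           | P in adversaryH U])).
  apply: le_ereal_inf_tmp => _ [P UP <-]; rewrite lee_fin.
  have -> : \sum_s mu s * v s - eps = \sum_s mu s * (v s - eps).
    under [RHS]eq_bigr do rewrite mulrBr.
    by rewrite sumrB -mulr_suml hmu.2 mul1r.
  by apply: ler_sum => s _; apply: ler_wpM2l => //; exact: piv.
apply: ereal_sup_ubound; exists (stationary pi) => //.
by move=> h; exact: pi_policy.
Qed.
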